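(* Let $n$ and $d$ be integers with $2\leq d<\lfloor n/2\rfloor$. Then $2d\leq \sigma^{-}(C_n^{d})\leq d(d+1)$.
   Context: $C_n$ denotes the cycle on $n$ vertices $u_0,u_1,\dots,u_{n-1}$. For a graph $G$, its $d$th power $G^d$ has vertex set $V(G)$, with distinct $u,v$ adjacent iff $1\leq \mathrm{dist}_G(u,v)\leq d$; thus $C_n^d$ is the circulant graph in which $u_i$ is adjacent to $u_{i\pm 1},\dots,u_{i\pm d}$ (indices mod $n$). For a graph $G$ on $n$ vertices, the rna number $\sigma^{-}(G)$ is the minimum, over all partitions $V(G)=A\cup B$ with $A\cap B=\emptyset$ and $||A|-|B||\leq 1$, of the number of edges of $G$ with one endpoint in $A$ and the other in $B$ (equivalently, the least number of negative edges among all parity signed graphs over $G$). *)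

(* Defs.v *)
From mathcomp Require Import all_boot.

Set Implicit Arguments.
Unset Strict Implicit.
Unset Printing Implicit Defensive.

(* A finite simple graph on the vertex type T is given by its adjacency
   relation e : rel T, which is symmetric and irreflexive. *)

Section Graph.

Variables (T : finType) (e : rel T).

Definition walk (k : nat) (u v : T) : bool :=
  [exists p : k.-tuple T, path e u p && (last u p == v)].

(* None stands for an infinite distance. Searching the lengths below #|T|
   loses nothing, since a shortest walk repeats no vertex: see gdistP. *)
Definition gdist (u v : T) : option nat :=
  ohead [seq k <- iota 0 #|T| | walk k u v].

Definition gpow (d : nat) : rel T :=
  fun u v => (u != v) && (if gdist u v is Some k then 1 <= k <= d else false).

Definition edges : {set {set T}} :=
  [set E : {set T} | [exists u, exists v, e u v && (E == [set u; v])]].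

Definition cut (A B : {set T}) : {set {set T}} :=
  [set E in edges | [exists u in A, exists v in B, E == [set u; v]]].

Definition balanced_partition (A B : {set T}) : bool :=
  [&& A :|: B == [set: T], A :&: B == set0,
      #|A| <= #|B| + 1 & #|B| <= #|A| + 1].

Definition balanced_cut_size (m : nat) : bool :=
  [exists A, exists B, balanced_partition A B && (#|cut A B| == m)].

Lemma ex_balanced_cut_size : exists m, balanced_cut_size m.
Proof.
pose A : {set T} := [set x in take #|T|./2 (enum T)].
have cA : #|A| = #|T|./2.
  rewrite cardsE (card_uniqP (take_uniq _ (enum_uniq T))) size_take -cardE.
  case: ltnP => // h; apply/eqP; rewrite eqn_leq h /=.
  by rewrite leq_half_double -addnn leqW ?leq_addr.
exists #|cut A (~: A)|; apply/existsP; exists A; apply/existsP; exists (~: A).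
rewrite eqxx andbT /balanced_partition setUCr setICr !eqxx /=.
rewrite [#|~: A|]cardsCs setCK cA.
have := odd_double_half #|T|; rewrite -addnn => E.
have -> : #|T| - #|T|./2 = odd #|T| + #|T|./2 by rewrite -{1}E addnA addnK.
rewrite addn1 addnC -addnS leq_addr /=.
by rewrite leq_add2l; case: odd.
Qed.

Definition rna : nat := ex_minn ex_balanced_cut_size.

Lemma walkP k u v :
  reflect (exists p, [/\ path e u p, last u p = v & size p = k]) (walk k u v).
Proof.
apply: (iffP existsP) => [[p /andP[pp /eqP lp]]|[p [pp lp sp]]].
  by exists p; rewrite size_tuple.
by exists (Tuple (introT eqP sp)); rewrite /= pp lp eqxx.
Qed.

Lemma gdistP u v k :
  gdist u v = Some k <-> walk k u v /\ (forall j, j < k -> ~~ walk j u v).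
Proof.
have wlt j : walk j u v -> exists2 i, walk i u v & i < #|T| /\ i <= j.
  case/walkP=> p [pp lp <-].
  case: (shortenP pp) lp => p' pp' up' sub lp'.
  exists (size p'); first by apply/walkP; exists p'.
  split; first by rewrite -[_.+1](card_uniqP up') max_card.
  by apply: uniq_leq_size sub; case/andP: up'.
have gen m n : ohead [seq i <- iota m n | walk i u v] = Some k <->
    [/\ m <= k < m + n, walk k u v & forall j, m <= j < k -> ~~ walk j u v].
  elim: n m => [|n IH] m /=.
    split=> // -[]; rewrite addn0 => /andP[h1 h2] _ _.
    by move: (leq_trans h2 h1); rewrite ltnn.
  case: ifP => wm /=.
    split=> [[<-]|[/andP[le_mk _] wk min]].
      rewrite leqnn addnS ltnS leq_addr; split=> // j /andP[h1 h2].
      by move: (leq_trans h2 h1); rewrite ltnn.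
    move: le_mk; rewrite leq_eqVlt => /orP[/eqP-> //|lt_mk].
    by have := min m; rewrite leqnn lt_mk wm => /(_ isT).
  split=> [/IH[/andP[h1 h2] wk min]|[/andP[h1 h2] wk min]].
    split=> //; first by rewrite (ltnW h1) addnS -addSn h2.
    move=> j /andP[]; rewrite leq_eqVlt => /orP[/eqP<- _|h3 h4].
      by rewrite wm.
    by apply: min; rewrite h3.
  apply/IH; split=> //.
    rewrite addSn -addnS h2 andbT ltn_neqAle h1 andbT.
    by apply: contraFneq wm => ->.
  by move=> j /andP[h3 h4]; apply: min; rewrite (ltnW h3).
split=> [/gen[_ wk min]|[wk min]].
  by split=> // j; apply: min.
apply/gen; split=> //.
have [i wi [lti leik]] := wlt _ wk.
rewrite add0n (leq_ltn_trans _ lti) //.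
by rewrite leqNgt; apply: contraL wi => /min.
Qed.

Lemma gpow_irrefl d : irreflexive (gpow d).
Proof. by move=> u; rewrite /gpow eqxx. Qed.

Lemma gpow_sym d : symmetric e -> symmetric (gpow d).
Proof.
move=> e_sym u v; rewrite /gpow eq_sym.
suff -> : gdist u v = gdist v u by [].
suff w k x y : walk k x y -> walk k y x.
  by congr ohead; apply: eq_filter => k; apply/idP/idP; apply: w.
case/walkP=> p [pp lp sp]; apply/walkP; exists (rev (belast x p)).
split; first by rewrite -lp rev_path (eq_path (e' := e)) // => a b; apply: e_sym.
  by case: p pp lp sp => [|z p] //= _ _ _; rewrite rev_cons last_rcons.
by rewrite size_rev size_belast.
Qed.

End Graph.

(* ordS i is the residue i + 1 mod n. *)
Definition cycle_graph (n : nat) : rel 'I_n :=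
  fun i j => (i != j) && ((j == ordS i) || (i == ordS j)).

Lemma cycle_graph_irrefl n : irreflexive (cycle_graph (n := n)).
Proof. by move=> i; rewrite /cycle_graph eqxx. Qed.

Lemma cycle_graph_sym n : symmetric (cycle_graph (n := n)).
Proof. by move=> i j; rewrite /cycle_graph eq_sym orbC. Qed.

(* Main.v *)
(** Lower bound: let [A] be one side of a balanced partition and let [i], [i+1]
    be consecutive vertices on different sides.  The edge [{i, i+1}] is cut, and
    each of the [2(d-1)] common neighbours of [i] and [i+1] is separated from
    exactly one of them, which gives [2d-1] cut edges, all meeting [{i, i+1}].
    As each side has at least three vertices, the remaining vertices
    [i+2, ..., i-1] are not all on the same side, so some edge
    [{j, j+1}] avoiding [{i, i+1}] is cut as well.

    Upper bound: split the cycle into two arcs.  Across each of the two places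
    where the arcs meet there are [k] edges of length [k], for each [k <= d];
    hence at most [2 (1 + ... + d) = d (d + 1)] edges in total. *)
Require Import Defs.
From mathcomp Require Import all_boot.
From mathcomp Require Import zify.

Set Implicit Arguments.
Unset Strict Implicit.
Unset Printing Implicit Defensive.

Lemma gpowP (T : finType) (e : rel T) d u v :
  reflect (u != v /\ exists2 k, k <= d & walk e k u v) (gpow e d u v).
Proof.
rewrite /gpow; apply: (iffP andP) => -[uv].
  case g: (gdist e u v) => [k|] // /andP[_ le_kd].
  by split=> //; exists k => //; case/gdistP: g.
case=> k le_kd wk; have exw : exists j, walk e j u v by exists k.
case: (ex_minnP exw) => j wj min_j; split=> //.
have -> : gdist e u v = Some j.
  by apply/gdistP; split=> // i; apply: contraTN => /min_j; rewrite -leqNgt.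
rewrite (leq_trans (min_j _ wk) le_kd) andbT lt0n.
apply: contraNneq uv => j0; move: wj; rewrite j0 => /walkP[p [_ lp /size0nil p0]].
by rewrite -lp p0.
Qed.

Section Cuts.

Variables (T : finType) (e : rel T).
Hypothesis e_sym : symmetric e.

Lemma cutP (A : {set T}) (E : {set T}) :
  reflect (exists u v, [/\ e u v, u \in A, v \notin A & E = [set u; v]])
          (E \in cut e A (~: A)).
Proof.
apply: (iffP idP) => [|[u [v [euv uA vA ->]]]]; last first.
  rewrite !inE; apply/andP; split.
    by apply/existsP; exists u; apply/existsP; exists v; rewrite euv eqxx.
  apply/existsP; exists u; rewrite uA; apply/existsP; exists v.
  by rewrite inE vA eqxx.
rewrite !inE => /andP[/existsP[x /existsP[y /andP[exy /eqP Exy]]]].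
case/existsP=> u /andP[uA /existsP[v /andP[]]]; rewrite inE => vA /eqP Euv.
exists u, v; split=> //.
have uv : u != v by apply: contraNneq vA => <-.
have : u \in [set x; y] by rewrite -Exy Euv set21.
have : v \in [set x; y] by rewrite -Exy Euv set22.
rewrite !inE => /orP[]/eqP v_eq /orP[]/eqP u_eq; subst u v => //.
- by rewrite eqxx in uv.
- by rewrite e_sym.
- by rewrite eqxx in uv.
Qed.

Lemma mem_cut (A : {set T}) u v :
  e u v -> (u \in A) != (v \in A) -> [set u; v] \in cut e A (~: A).
Proof.
move=> euv; case: (boolP (u \in A)) (boolP (v \in A)) => uA [] vA // _.
  by apply/cutP; exists u, v.
by apply/cutP; exists v, u; rewrite e_sym setUC.
Qed.

Lemma balanced_partition_setC (A B : {set T}) :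
  balanced_partition A B -> B = ~: A.
Proof.
case/and4P=> /eqP U /eqP I _ _; apply/setP=> x.
have := in_setT x; have := in_set0 x; rewrite -U -I !inE.
by case: (x \in A); case: (x \in B).
Qed.

Lemma rna_ge m :
  (forall A, balanced_partition A (~: A) -> m <= #|cut e A (~: A)|) ->
  m <= rna e.
Proof.
move=> h; rewrite /rna; case: ex_minnP => k + _.
case/existsP=> A /existsP[B /andP[bAB /eqP <-]].
by have eqB := balanced_partition_setC bAB; subst B; apply: h.
Qed.

Lemma rna_le (A B : {set T}) : balanced_partition A B -> rna e <= #|cut e A B|.
Proof.
move=> bAB; rewrite /rna; case: ex_minnP => k _; apply.
by apply/existsP; exists A; apply/existsP; exists B; rewrite bAB eqxx.
Qed.

End Cuts.

Section Cycle.

Variable n : nat.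
Hypothesis n_gt1 : 1 < n.

Definition cdist (u v : nat) := minn ((u - v) + (v - u)) (n - ((u - v) + (v - u))).

Lemma val_ordS (i : 'I_n) : ordS i = (if i.+1 == n then 0 else i.+1) :> nat.
Proof.
rewrite /=; case: eqP => [->|/eqP ne]; first exact: modnn.
by rewrite modn_small // ltn_neqAle ne ltn_ord.
Qed.

Lemma val_iter_ordS (i : 'I_n) k :
  k <= n -> iter k (@ordS n) i = (if i + k < n then i + k else i + k - n) :> nat.
Proof.
have lt_i := ltn_ord i.
elim: k => [|k IH] lt_k; first by rewrite addn0 lt_i.
rewrite iterS val_ordS (IH (ltnW lt_k)).
by case: (ltnP (i + k) n) => ?; do ?case: ifP => ?; lia.
Qed.

Lemma eq_iter_ordS (i : 'I_n) j k : j < n -> k < n ->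
  (iter j (@ordS n) i == iter k (@ordS n) i) = (j == k).
Proof.
move=> lt_j lt_k; have := ltn_ord i.
rewrite -(inj_eq (@ord_inj n)) !val_iter_ordS; try exact: ltnW.
by case: (ltnP (i + j)) => ?; case: (ltnP (i + k)) => ?; lia.
Qed.

Lemma cdist_iter_ordS (i : 'I_n) j k : j < n -> k < n ->
  cdist (iter j (@ordS n) i) (iter k (@ordS n) i) = cdist j k.
Proof.
move=> lt_j lt_k; have := ltn_ord i.
rewrite /cdist !val_iter_ordS; try exact: ltnW.
by case: (ltnP (i + j)) => ?; case: (ltnP (i + k)) => ?; lia.
Qed.

Lemma cycle_graph_ordS (i : 'I_n) : cycle_graph i (ordS i).
Proof.
rewrite /cycle_graph eqxx andbT -(inj_eq (@ord_inj n)) val_ordS.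
by case: ifP; lia.
Qed.

Lemma walk_iter_ordS (i : 'I_n) k :
  walk (@cycle_graph n) k i (iter k (@ordS n) i).
Proof.
apply/walkP; exists (traject (@ordS n) (ordS i) k).
rewrite last_traject size_traject; split=> //.
elim: k i => //= k IH i; by rewrite cycle_graph_ordS IH.
Qed.

Lemma cdist_path (u v : 'I_n) p :
  path (@cycle_graph n) u p -> last u p = v -> cdist u v <= size p.
Proof.
elim: p u => [|w p IH] u /=; first by move=> _ ->; rewrite /cdist; lia.
case/andP=> /andP[_ uw] /IH/[apply]; rewrite /cdist.
have := ltn_ord u; have := ltn_ord v; have := ltn_ord w.
by case/orP: uw => /eqP/(congr1 (@nat_of_ord n)); rewrite val_ordS; case: ifP; lia.
Qed.

Lemma walk_cdist (u v : 'I_n) :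
  walk (@cycle_graph n) (cdist u v) u v \/ walk (@cycle_graph n) (cdist u v) v u.
Proof.
have lt_u := ltn_ord u; have lt_v := ltn_ord v.
have le_n : cdist u v <= n by rewrite /cdist; lia.
have [E|E] : v = iter (cdist u v) (@ordS n) u \/ u = iter (cdist u v) (@ordS n) v.
- have [h|h] : nat_of_ord v = iter (cdist u v) (@ordS n) u \/
               nat_of_ord u = iter (cdist u v) (@ordS n) v.
    by rewrite !val_iter_ordS // /cdist; do ?case: ifP => ?; lia.
  + by left; apply: val_inj.
  + by right; apply: val_inj.
- by left; rewrite {2}E; apply: walk_iter_ordS.
- by right; rewrite {2}E; apply: walk_iter_ordS.
Qed.

Lemma gpow_cycleE d (u v : 'I_n) :
  gpow (@cycle_graph n) d u v = (u != v) && (cdist u v <= d).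
Proof.
apply/gpowP/andP=> [[uv [k le_k /walkP[p [pp lp sp]]]]|[uv le_d]].
  by split=> //; apply: leq_trans le_k; rewrite -sp cdist_path.
apply/gpowP; have [w|w] := walk_cdist u v; last rewrite (gpow_sym d (@cycle_graph_sym n)).
  by apply/gpowP; split=> //; exists (cdist u v).
by apply/gpowP; rewrite eq_sym; split=> //; exists (cdist u v).
Qed.

Lemma exists_boundary (A : {set 'I_n}) (i : 'I_n) :
  2 < #|A| -> 2 < #|~: A| ->
  exists k, [/\ 1 < k, k.+1 < n &
    (iter k (@ordS n) i \in A) != (iter k.+1 (@ordS n) i \in A)].
Proof.
set w := fun k => iter k (@ordS n) i => cA cB.
have lt_i := ltn_ord i.
have vw k : k <= n -> w k = (if i + k < n then i + k else i + k - n) :> nat.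
  exact: val_iter_ordS.
case: (boolP [exists k : 'I_n,
    [&& 1 < k, k.+1 < n & (w k \in A) != (w k.+1 \in A)]]).
  by case/existsP=> k /and3P[h1 h2 h3]; exists k.
rewrite negb_exists => /forallP noB; exfalso.
have const k : 1 < k < n -> (w k \in A) = (w 2 \in A).
  elim: k => // k IH /andP[h1 h2].
  have [->//|k1] := eqVneq k 1.
  have h3 : 1 < k by lia.
  rewrite -IH ?h3 ?(ltnW h2) //; have := noB (Ordinal (ltnW h2)).
  by rewrite /= h3 h2 /= negbK => /eqP ->.
have out x : x \notin [set w 0; w 1] -> (x \in A) = (w 2 \in A).
  rewrite !inE negb_or -!(inj_eq (@ord_inj n)) !vw //; last by apply: ltnW.
  move=> /andP[x0 x1].
  have lt_x := ltn_ord x.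
  have [k [k1 kn xk]] : exists k, [/\ 1 < k, k < n & x = w k].
    exists (if i <= x then x - i else x + n - i).
    move: x0 x1; case: (ltnP (i + 0)) => ?; case: (ltnP (i + 1)) => ?;
      case: (leqP i x) => ? x0 x1; split;
      first [lia | by apply: ord_inj; rewrite vw; do ?case: ifP => ?; lia].
  by rewrite xk const ?k1.
have small (S : {set 'I_n}) : S \subset [set w 0; w 1] -> #|S| <= 2.
  by move/subset_leq_card/leq_trans; apply; rewrite cards2; case: (_ != _).
case: (boolP (w 2 \in A)) => w2.
- have /small : ~: A \subset [set w 0; w 1]; last by rewrite leqNgt cB.
  apply/subsetP=> x; rewrite inE; apply: contraR => /out ->; exact: w2.
- have /small : A \subset [set w 0; w 1]; last by rewrite leqNgt cA.
  by apply/subsetP=> x; apply: contraLR => /out ->.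
Qed.

Lemma gpow_cycle_cut_ge d (A : {set 'I_n}) :
  1 < d -> d < n./2 -> 2 < #|A| -> 2 < #|~: A| ->
  2 * d <= #|cut (gpow (@cycle_graph n) d) A (~: A)|.
Proof.
move=> d_gt1 d_lt cA cB.
have e_sym := gpow_sym d (@cycle_graph_sym n).
have [i wA] : exists i : 'I_n, (i \in A) != (ordS i \in A).
  have /card_gt0P[i0 _] : 0 < #|A| by apply: leq_trans cA.
  by have [k [_ _ h]] := exists_boundary i0 cA cB; exists (iter k (@ordS n) i0).
have [m [m_gt1 m_lt mA]] := exists_boundary i cA cB.
set w := fun k => iter k (@ordS n) i.
have w_eq j k : j < n -> k < n -> (w j == w k) = (j == k).
  exact: eq_iter_ordS.
have w_adj j k : j < n -> k < n -> j != k -> cdist j k <= d ->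
    gpow (@cycle_graph n) d (w j) (w k).
  by move=> hj hk jk ?; rewrite gpow_cycleE w_eq // jk cdist_iter_ordS.
(* [w (q k)] is the one of [i], [i + 1] lying on the other side than [w k]. *)
pose q k := if (w k \in A) == (w 0 \in A) then 1 else 0.
pose E k := [set w k; w (q k)].
pose K := iota 1 d ++ iota (n - d).+1 d.-1.
have q_le k : q k <= 1 by rewrite /q; case: ifP.
have KP k : k \in K -> 0 < k < n /\ (k <= d \/ n - d < k).
  by rewrite mem_cat !mem_iota; lia.
have q1 : q 1 = 0 by rewrite /q eq_sym (negPf wA).
pose s := [set w m; w m.+1] :: map E K.
have -> : 2 * d = size s by rewrite /= size_map size_cat !size_iota; lia.
rewrite cardE; apply: uniq_leq_size; last first.
  move=> X; rewrite mem_enum inE => /orP[/eqP->|/mapP[k /KP[kn kd] ->]].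
    by apply: mem_cut => //; apply: w_adj; rewrite /cdist; lia.
  have qk : q k != k.
    by have := q_le k; have [->|] := eqVneq k 1; [rewrite q1|lia].
  apply: mem_cut => //.
    by apply: w_adj; rewrite ?(eq_sym k) //; have := q_le k; rewrite /cdist; lia.
  rewrite /q; case: ifP => [/eqP ->//|/negbT //].
rewrite /s cons_uniq; apply/andP; split.
  apply/mapP=> -[k /KP[kn _] EE].
  have : w (q k) \in [set w m; w m.+1] by rewrite EE set22.
  by rewrite !inE !w_eq; have := q_le k; lia.
rewrite map_inj_in_uniq.
  rewrite cat_uniq !iota_uniq andbT /=.
  by apply/hasPn=> k /=; rewrite !mem_iota; lia.
move=> k l /KP[kn _] /KP[ln _] EE.
have : w k \in E l by rewrite -EE set21.
have : w l \in E k by rewrite EE set21.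
by rewrite !inE !w_eq; have := q_le k; have := q_le l; lia.
Qed.

Lemma card_ord_lt h : h <= n -> #|[set x : 'I_n | x < h]| = h.
Proof. by move=> le_h; rewrite -sum1dep_card (big_ord_narrow le_h) sum1_card card_ord. Qed.

(* The [d * (d + 1)] pairs [(k, t)] with [k < d] and [t <= d] enumerate the
   edges across both ends of the arc: those with [t <= k] give the edges of
   length [k + 1] around [h], those with [k < t] the edges of length [t]
   around [0]. *)
Lemma gpow_cycle_cut_arc d h (A := [set x : 'I_n | x < h]) :
  #|cut (gpow (@cycle_graph n) d) A (~: A)| <= d * (d + 1).
Proof.
have e_sym := gpow_sym d (@cycle_graph_sym n).
have n_gt0 : 0 < n by apply: ltnW.
pose pt k : 'I_n := Ordinal (ltn_pmod k n_gt0).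
have ptE (k : nat) (u : 'I_n) : k = u :> nat \/ k = n + u -> pt k = u.
  by case=> ->; apply: val_inj; rewrite /= ?modnDl modn_small.
pose f (p : 'I_d * 'I_d.+1) := let: (k, t) := p in
  if t <= k then [set pt (h.-1 - t); pt (h - t + k)]
  else [set pt (n.-1 - k + t); pt (n.-1 - k)].
have -> : d * (d + 1) = #|{: 'I_d * 'I_d.+1}| by rewrite card_prod !card_ord addn1.
apply: leq_trans (leq_imset_card f _); apply/subset_leq_card/subsetP=> X.
case/(cutP e_sym)=> u [v []]; rewrite gpow_cycleE !inE -leqNgt.
case/andP=> _ uv uh vh ->; apply/imsetP.
have lt_u := ltn_ord u; have lt_v := ltn_ord v.
have [near|far] : v - u <= d \/ n - (v - u) <= d by move: uv; rewrite /cdist; lia.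
  have hk : (v - u).-1 < d by lia.
  have ht : h.-1 - u < d.+1 by lia.
  exists (Ordinal hk, Ordinal ht) => //=; rewrite ifT; last by lia.
  by congr [set _; _]; apply/esym/ptE; lia.
have hk : n.-1 - v < d by lia.
have ht : n - (v - u) < d.+1 by lia.
exists (Ordinal hk, Ordinal ht) => //=; rewrite ifF; last by lia.
by congr [set _; _]; apply/esym/ptE; lia.
Qed.

End Cycle.

Theorem theorem3p2 (n d : nat) (hd : 2 <= d) (hdn : d < n./2) :
  2 * d <= rna (gpow (@cycle_graph n) d) /\
  rna (gpow (@cycle_graph n) d) <= d * (d + 1).
Proof.
have n_gt1 : 1 < n by lia.
split.
  apply: rna_ge => A /and4P[_ _ le1 le2].
  have := cardsC A; rewrite card_ord => cAC.
  by move: le1 le2 cAC; set a := #|A|; set b := #|~: A| => *;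
    apply: gpow_cycle_cut_ge => //; rewrite -?/a -?/b; lia.
set A := [set x : 'I_n | x < n./2].
apply: leq_trans (rna_le _ (B := ~: A) _) (gpow_cycle_cut_arc n_gt1 d n./2).
have cA : #|A| = n./2 by apply: card_ord_lt; lia.
rewrite /balanced_partition setUCr setICr !eqxx cA /=.
by have := cardsC A; rewrite card_ord cA; set b := #|~: A|; lia.
Qed.
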